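(* For every integer $k\ge 0$, let $y_{4k+1}$ be the largest real root of the Bernoulli polynomial $B_{4k+1}(x)$ and let $c_{4k+1}$ be the number of real roots of $B_{4k+1}(x)$, counted with multiplicity. Then $$c_{4k+1}=4\lceil y_{4k+1}\rceil-3,$$ where $\lceil x\rceil$ is the smallest integer greater than or equal to $x$.
   Context: The Bernoulli polynomials $B_n(x)\in\mathbb{Q}[x]$ are defined by the identity $\frac{te^{tx}}{e^t-1}=\sum_{n=0}^\infty \frac{B_n(x)}{n!}t^n$ in $\mathbb{Q}[x][[t]]$. *)

(* Defs.v *)
From mathcomp Require Import all_boot all_order all_algebra.
From mathcomp Require Import reals polyrcf.

Set Implicit Arguments.
Unset Strict Implicit.
Unset Printing Implicit Defensive.

Import Order.TTheory GRing.Theory Num.Theory.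
Local Open Scope ring_scope.

(* An element of Q[x][[t]] is given by its sequence of coefficients in t. *)
Definition fps := nat -> {poly rat}.

Definition fps_mul (u v : fps) : fps :=
  fun n => \sum_(i < n.+1) u i * v (n - i)%N.

Definition fps_sub (u v : fps) : fps := fun n => u n - v n.

Definition fps_one : fps := fun n => (n == 0%N)%:R.

Definition fps_t : fps := fun n => (n == 1%N)%:R.

(* sum_n (u_n / n!) t^n; with u_n = p ^+ n this is e^(p t). *)
Definition fps_egf (u : nat -> {poly rat}) : fps :=
  fun n => (n`!%:R)^-1 *: u n.

Definition fps_exp (p : {poly rat}) : fps := fps_egf (fun n => p ^+ n).

(* t e^(tx) / (e^t - 1) = sum_n (B_n(x) / n!) t^n in Q[x][[t]].  The series
   e^t - 1 is a nonzero non-unit of the domain Q[x][[t]], so the quotient is the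
   unique series whose product with e^t - 1 is t e^(tx). *)
Definition bernoulli_polys (B : nat -> {poly rat}) : Prop :=
  fps_mul (fps_sub (fps_exp 1) fps_one) (fps_egf B) =1
  fps_mul fps_t (fps_exp 'X).

Definition real_poly (R : realType) (p : {poly rat}) : {poly R} :=
  map_poly ratr p.

Definition largest_root (R : realType) (p : {poly R}) (y : R) : Prop :=
  root p y /\ forall z : R, root p z -> z <= y.

Definition num_roots (R : realType) (p : {poly R}) : nat :=
  (\sum_(z <- rootsR p) mup z p)%N.

Lemma bernoulli_polysP (B : nat -> {poly rat}) :
  bernoulli_polys B <->
  forall n, \sum_(i < n.+1) ((n - i).+1`!%:R)^-1 *: fps_egf B i =
            fps_exp 'X n.
Proof.
have hR n : fps_mul fps_t (fps_exp 'X) n.+1 = fps_exp 'X n.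
  rewrite /fps_mul big_ord_recl mul0r add0r big_ord_recl /= mul1r subn1.
  by rewrite big1 ?addr0 // => i _; rewrite mul0r.
have hL n : fps_mul (fps_sub (fps_exp 1) fps_one) (fps_egf B) n.+1 =
    \sum_(i < n.+1) ((n - i).+1`!%:R)^-1 *: fps_egf B i.
  rewrite /fps_mul big_ord_recl /= {1}/fps_sub {1}/fps_exp {1}/fps_egf.
  rewrite fact0 invr1 scale1r expr0 subrr mul0r add0r.
  rewrite [RHS](reindex_inj rev_ord_inj) /=; apply: eq_bigr => i _.
  rewrite /bump /= add1n !subSS subKn; last by rewrite -ltnS.
  by rewrite /fps_sub /fps_exp /fps_one {1}/fps_egf expr1n /= subr0 -scalerAl mul1r.
split=> [hB n | hB [|n]]; first by rewrite -hL hB hR.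
  rewrite /fps_mul !big_ord_recl !big_ord0 !addr0 /fps_sub /fps_exp {1}/fps_egf.
  by rewrite fact0 invr1 scale1r expr0 subrr !mul0r.
by rewrite hL hR.
Qed.

Lemma bernoulli_polys_unique (B C : nat -> {poly rat}) :
  bernoulli_polys B -> bernoulli_polys C -> B =1 C.
Proof.
move=> /bernoulli_polysP hB /bernoulli_polysP hC n.
have fact_neq0 m : (m`!%:R : rat)^-1 != 0.
  by rewrite invr_eq0 pnatr_eq0 -lt0n fact_gt0.
elim/ltn_ind: n => n IHn.
have := etrans (hB n) (esym (hC n)).
rewrite !big_ord_recr /= subnn invr1 !scale1r.
under eq_bigr => i _ do rewrite /fps_egf (IHn _ (ltn_ord i)).
by move=> /addrI; apply: scalerI; apply: fact_neq0.
Qed.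

Lemma bernoulli_polys_exist : exists B, bernoulli_polys B.
Proof.
pose step (s : seq {poly rat}) := let n := size s in rcons s
  (fps_exp 'X n - \sum_(i < n) ((n - i).+1`!%:R)^-1 *: nth 0 s i).
pose s n := iter n step [::].
have size_s n : size (s n) = n.
  by elim: n => //= n IHn; rewrite /step size_rcons IHn.
pose c n := nth 0 (s n.+1) n.
have nth_s n i : (i < n)%N -> nth 0 (s n) i = c i.
  elim: n => // n IHn; rewrite ltnS leq_eqVlt => /predU1P[-> // | lt_in].
  by rewrite /s /= -/(s n) /step nth_rcons size_s lt_in IHn.
exists (fun n => n`!%:R *: c n); apply/bernoulli_polysP => n.
have egfE i : fps_egf (fun n => n`!%:R *: c n) i = c i.
  rewrite /fps_egf scalerA mulVf ?scale1r //.
  by rewrite pnatr_eq0 -lt0n fact_gt0.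
under eq_bigr => i _ do rewrite egfE.
rewrite big_ord_recr /= subnn invr1 scale1r.
rewrite [X in _ + X]/c /s /= -/(s n) /step nth_rcons size_s ltnn eqxx.
under [X in _ - X]eq_bigr => i _ do rewrite (nth_s _ _ (ltn_ord i)).
by rewrite addrC subrK.
Qed.

(* Main.v *)
(* For n = 4k + 5, the signs of the odd Bernoulli polynomials on [0, 1/2] follow by
   induction from convexity, as B_n'' = n (n - 1) B_{n-2}.  Let m >= 1 be an integer.
   By B_n(x + 1) = B_n(x) + n x^(n-1), B_n is positive on [m + 1/2, m + 1) and, since
   B_{n-2} > 0 on (0, 1/2), strictly convex on [m, m + 1/2].  Moreover B_n(m) > 0 for
   m > 1, while B_n(1) = 0 > B_n'(1).  So, counting multiplicities, [m, m + 1) contains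
   either no root or exactly two; and if it contains none, the shift equation excludes
   all larger roots.  Hence there are 2 (ceil y - 1) roots above 1/2, as many below by
   the symmetry x -> 1 - x, and the simple root 1/2. *)

Require Import Defs.
From mathcomp Require Import all_boot all_order all_algebra.
From mathcomp Require Import reals polyrcf polyorder.
From mathcomp Require Import ring lra zify.

Set Implicit Arguments.
Unset Strict Implicit.
Unset Printing Implicit Defensive.

Import Order.TTheory GRing.Theory Num.Theory.
Local Open Scope ring_scope.

(** * Appell sequences, difference equation and reflection *)

Lemma factr_neq0 n : n`!%:R != 0 :> rat.
Proof. by rewrite pnatr_eq0 -lt0n fact_gt0. Qed.

Lemma appell_egf (C : nat -> {poly rat}) n :
  (forall n, (C n.+1)^`() = C n *+ n.+1) -> (fps_egf C n.+1)^`() = fps_egf C n.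
Proof.
move=> dC; rewrite /fps_egf derivZ dC -scaler_nat scalerA factS natrM invfM.
by rewrite mulrAC mulVf ?mul1r // pnatr_eq0.
Qed.

(** Taylor's formula with increment 1: with u_n = C_n / n!, the i-th derivative of u_n is
    u_(n-i). *)
Lemma appell_taylor (C : nat -> {poly rat}) n :
    (C 0%N)^`() = 0 -> (forall n, (C n.+1)^`() = C n *+ n.+1) ->
  fps_egf C n \Po ('X + 1) = \sum_(i < n.+1) (i`!%:R)^-1 *: fps_egf C (n - i)%N.
Proof.
move=> dC0 dC; set u := fps_egf C.
have du m : (u m.+1)^`() = u m by exact: appell_egf.
have du0 : (u 0%N)^`() = 0 by rewrite /u /fps_egf derivZ dC0 scaler0.
(* Differentiation lowers the degree by one, so the expansion can stop after n + 1 terms. *)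
have size_u m : (size (u m) <= m.+1)%N.
  elim: m => [|m]; last by rewrite -du size_deriv; case: size.
  have := congr1 (fun p : {poly rat} => size p) du0.
  by rewrite size_deriv size_poly0; case: size => [|[]].
have dnu i : (i <= n)%N -> (u n)^`(i) = u (n - i)%N.
  elim: i => [|i IHi] lt_in; first by rewrite subn0.
  by rewrite derivnS IHi 1?ltnW // -subSS subSn // du.
rewrite /comp_poly (@nderiv_taylor_wide _ n.+1); last first.
- by rewrite (leq_trans (size_poly _ _)).
- exact: commr1.
apply: eq_bigr => i _; rewrite expr1n mulr1 nderivn_map.
rewrite -/(_ \Po 'X) comp_polyXr -dnu -1?ltnS // nderivn_def -scaler_nat.
by rewrite scalerA mulVf ?scale1r // factr_neq0.
Qed.

Lemma bernoulli0 B (hB : bernoulli_polys B) : B 0%N = 1.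
Proof.
have /bernoulli_polysP/(_ 0%N) := hB.
by rewrite big_ord1 /fps_exp /fps_egf !fact0 invr1 !scale1r.
Qed.

(** Differentiating the recurrence of [bernoulli_polysP] shows that B_(n+1)' / (n+1) satisfies it
    again; uniqueness concludes. *)
Lemma deriv_bernoulli B (hB : bernoulli_polys B) n : (B n.+1)^`() = B n *+ n.+1.
Proof.
pose C n := (n.+1%:R)^-1 *: (B n.+1)^`().
suff /bernoulli_polys_unique/(_ hB n) <-: bernoulli_polys C.
  by rewrite -scaler_nat scalerA mulfV ?scale1r // pnatr_eq0.
apply/bernoulli_polysP => m.
have /bernoulli_polysP/(_ m.+1)/(congr1 (fun p => p^`())) := hB.
rewrite big_ord_recl derivD {1}/fps_egf bernoulli0 // !derivZ derivC !scaler0 add0r.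
rewrite raddf_sum /fps_exp /fps_egf /= derivXn -scaler_nat scalerA factS natrM.
rewrite invfM mulrAC mulVf ?mul1r ?pnatr_eq0 //= => <-.
apply: eq_bigr => i _; rewrite /bump /= add1n subSS !derivZ.
rewrite (factS i) natrM invfM /C !scalerA; congr (_ *: _).
by rewrite -?mulrA; congr (_ * _); rewrite mulrC.
Qed.

(** By [appell_taylor], the sum in the recurrence is (C_(n+1)(x+1) - C_(n+1)(x)) / (n+1)!. *)
Lemma bernoulli_polys_appell (C : nat -> {poly rat}) :
    (C 0%N)^`() = 0 -> (forall n, (C n.+1)^`() = C n *+ n.+1) ->
  bernoulli_polys C <->
  forall n, C n.+1 \Po ('X + 1) = C n.+1 + 'X^n *+ n.+1.
Proof.
move=> dC0 dC.
have sumE n : \sum_(i < n.+1) ((n - i).+1`!%:R)^-1 *: fps_egf C i =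
    (n.+1`!%:R)^-1 *: (C n.+1 \Po ('X + 1) - C n.+1).
  have := appell_taylor n.+1 dC0 dC; rewrite big_ord_recl fact0 invr1 scale1r subn0.
  rewrite scalerBr -comp_polyZ => ->; rewrite [in RHS]addrAC subrr add0r.
  rewrite (reindex_inj rev_ord_inj) /=; apply: eq_bigr => i _.
  by rewrite /bump /= add1n !subSS subKn // -ltnS.
have expE n : fps_exp 'X n = (n.+1`!%:R)^-1 *: ('X^n *+ n.+1) :> {poly rat}.
  rewrite -scaler_nat scalerA factS natrM invfM.
  by rewrite mulrAC mulVf ?mul1r // pnatr_eq0.
split=> [/bernoulli_polysP hC n | hC]; last first.
  by apply/bernoulli_polysP => n; rewrite sumE expE hC addrC addKr.
have := hC n; rewrite sumE expE => /scalerI <-; first by rewrite addrCA subrr addr0.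
by rewrite invr_eq0 factr_neq0.
Qed.

Lemma bernoulli_shift B (hB : bernoulli_polys B) n :
  B n.+1 \Po ('X + 1) = B n.+1 + 'X^n *+ n.+1.
Proof.
apply: (bernoulli_polys_appell _ _).1 => // [|m]; last exact: deriv_bernoulli.
by rewrite bernoulli0 //; exact: derivC.
Qed.

(** The sequence (-1)^m B_m(1 - x) is again Appell and satisfies the same difference equation, so
    uniqueness applies. *)
Lemma bernoulli_reflect B n : bernoulli_polys B ->
  B n \Po (1 - 'X) = (-1) ^+ n *: B n.
Proof.
move=> hB; pose C m := (-1) ^+ m *: (B m \Po (1 - 'X)).
suff hC : bernoulli_polys C.
  rewrite -[in RHS](bernoulli_polys_unique hC hB n).
  by rewrite scalerA -exprMn mulrNN mulr1 expr1n scale1r.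
apply/bernoulli_polys_appell => [|m|m]; rewrite /C.
- by rewrite bernoulli0 // expr0 scale1r comp_polyC; exact: derivC.
- rewrite derivZ deriv_comp deriv_bernoulli // !derivE sub0r mulrN1.
  by rewrite raddfMn scalerN exprS mulN1r scaleNr opprK scalerMnr.
have e1 : (1 - 'X) \Po ('X + 1) = - 'X :> {poly rat}.
  by rewrite comp_polyB comp_polyX comp_polyC; ring.
have e2 : ('X + 1) \Po (- 'X) = 1 - 'X :> {poly rat}.
  by rewrite comp_polyD comp_polyX comp_polyC addrC.
rewrite comp_polyZ -comp_polyA e1.
(* At -x the shift equation relates B_(m+1)(1 - x) to B_(m+1)(-x), the two values in the goal. *)
have := congr1 (fun p => p \Po (- 'X)) (bernoulli_shift hB m).
rewrite -comp_polyA e2 => ->; rewrite comp_polyD scalerDr -addrA.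
rewrite -[LHS]addr0; congr (_ + _); rewrite raddfMn /= comp_Xn_poly [(- 'X) ^+ m]exprNn.
rewrite -scalerMnr -mulrnDl exprS mulN1r scaleNr -[_ ^+ m]signr_odd.
rewrite -[X in _ *: (X * _)]signr_odd.
by case: (odd m); rewrite /= ?mul1r ?mulN1r ?scale1r ?scaleN1r ?opprK addNr mul0rn.
Qed.

Lemma deriv_real_bernoulli (R : realType) B n : bernoulli_polys B ->
  (real_poly R (B n.+1))^`() = n.+1%:R *: real_poly R (B n).
Proof.
by move=> hB; rewrite /real_poly deriv_map deriv_bernoulli // rmorphMn scaler_nat.
Qed.

Lemma real_bernoulli_shift (R : realType) B n (x : R) : bernoulli_polys B ->
  (real_poly R (B n.+1)).[x + 1] = (real_poly R (B n.+1)).[x] + n.+1%:R * x ^+ n.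
Proof.
move=> hB; have := congr1 (fun p => (real_poly R p).[x]) (bernoulli_shift hB n).
rewrite /real_poly map_comp_poly horner_comp !rmorphD /= map_polyX rmorph1 rmorphMn.
by rewrite /= map_polyXn !hornerD hornerX hornerC hornerMn hornerXn mulr_natl.
Qed.

Lemma real_bernoulli_reflect (R : realType) B n : bernoulli_polys B ->
  real_poly R (B n) \Po (1 - 'X) = (-1) ^+ n *: real_poly R (B n).
Proof.
move=> hB; have := congr1 (real_poly R) (bernoulli_reflect n hB).
rewrite /real_poly map_comp_poly rmorphB /= map_polyX rmorph1.
by rewrite map_polyZ rmorphXn rmorphN1.
Qed.

(** * Counting roots with multiplicity *)

Definition count_roots (R : rcfType) (P : pred R) (p : {poly R}) : nat :=
  (\sum_(z <- rootsR p | P z) mup z p)%N.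

Lemma mem_rootsR (R : rcfType) (p : {poly R}) z :
  p != 0 -> (z \in rootsR p) = root p z.
Proof. by move=> /roots_on_rootsR/(_ z); rewrite in_itv. Qed.

Lemma count_rootsE (R : rcfType) (P : pred R) (p : {poly R}) s : p != 0 ->
    uniq s -> (forall z, P z -> root p z -> z \in s) ->
  count_roots P p = (\sum_(z <- s | P z) mup z p)%N.
Proof.
move=> p0 uniq_s root_s.
have restrict t : (\sum_(z <- t | P z) mup z p =
    \sum_(z <- [seq z <- t | P z && root p z]) mup z p)%N.
  rewrite big_filter big_mkcondr /=; apply: eq_bigr => z _.
  by case: ifPn => // /mupNroot.
rewrite /count_roots !restrict; apply: perm_big; apply: uniq_perm.
- by rewrite filter_uniq ?uniq_roots.
- by rewrite filter_uniq.
move=> z; rewrite !mem_filter mem_rootsR //.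
by case: (boolP (P z)) => //= Pz; case: (boolP (root p z)) => //= /(root_s z Pz) ->.
Qed.

Lemma count_roots_eq0 (R : rcfType) (P : pred R) (p : {poly R}) :
  (forall z, P z -> ~~ root p z) -> count_roots P p = 0%N.
Proof. by move=> noroot; rewrite /count_roots big1 // => z /noroot /mupNroot. Qed.

Lemma count_roots_XsubCM (R : rcfType) (P : pred R) (q : {poly R}) z :
  q != 0 -> P z -> count_roots P (('X - z%:P) * q) = (count_roots P q).+1.
Proof.
(* One list containing the roots of both polynomials, so that the sums compare termwise. *)
move=> q0 Pz; set s := undup (z :: rootsR q).
have uniq_s : uniq s := undup_uniq _.
rewrite (@count_rootsE _ _ _ s) ?mulf_neq0 ?polyXsubC_eq0 //; last first.
  by move=> x _; rewrite mem_undup inE rootM root_XsubC mem_rootsR.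
rewrite (@count_rootsE _ _ q s) //; last first.
  by move=> x _ qx; rewrite mem_undup inE mem_rootsR // qx orbT.
under eq_bigr => x _ do rewrite mupM ?polyXsubC_eq0 // (@mup_XsubCX _ 1).
rewrite big_split /= -big_mkcondr /= sum1_count -add1n; congr (_ + _)%N.
rewrite -[RHS](_ : (z \in s : nat) = _)%N; last by rewrite mem_undup mem_head.
rewrite -count_uniq_mem //; apply: eq_count => x /=.
by case: eqVneq => [<-|]; rewrite ?Pz ?andbF // eqxx.
Qed.

(** * Roots of a polynomial with positive second derivative *)

Lemma rolle_weak (R : rcfType) (q : {poly R}) u v : u <= v ->
  let p := ('X - u%:P) * (('X - v%:P) * q) in
  exists c, [/\ p^`().[c] = 0, u <= c <= v & u < v -> u < c < v].
Proof.
move=> + p; rewrite le_eqVlt => /predU1P[uv | lt_uv].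
  (* A double root is itself a critical point. *)
  exists u; rewrite uv lexx ltxx; split => //.
  by rewrite /p uv derivM derivM !derivE !hornerE /=; ring.
have [|c] := @poly_rolle _ u v p lt_uv.
  by rewrite /p !hornerE /=; ring.
by rewrite in_itv /= => ltc pc; exists c; split => //; case/andP: ltc => /ltW -> /ltW ->.
Qed.

(** If u < w, two applications of Rolle give critical points c1 < c2, and a third gives a zero of
    p'' between them. If u = w > a, the triple root is itself a zero of p''. What remains is a
    triple root at a, where p'' is not assumed positive. *)
Lemma convex_triple_root_le (R : rcfType) (p q : {poly R}) a b u v w :
    (forall x, a < x < b -> 0 < p^`()^`().[x]) ->
    a <= u -> u <= v -> v <= w -> w < b ->
    p = ('X - u%:P) * (('X - v%:P) * (('X - w%:P) * q)) ->
  w = a.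
Proof.
move=> p''_gt0 au uv vw wb pE; apply/eqP; case: (eqVneq w a) => // w_neq_a.
have noroot x : a < x < b -> p^`()^`().[x] <> 0.
  by move=> /p''_gt0 p''x p''x0; rewrite p''x0 ltxx in p''x.
have [uw|uw] := eqVneq u w.
  case: (noroot w); first by rewrite wb andbT lt_neqAle eq_sym w_neq_a -uw.
  have vE : v = w by apply/le_anti; rewrite vw -{1}uw uv.
  by rewrite pE uw vE !(derivM, derivE) !hornerE /=; ring.
have [c1 [p'c1 uc1v uc1v']] := rolle_weak (('X - w%:P) * q) uv.
have [c2 [p'c2 vc2w vc2w']] := rolle_weak (('X - u%:P) * q) vw.
have pE2 : p = ('X - v%:P) * (('X - w%:P) * (('X - u%:P) * q)) by rewrite pE; ring.
rewrite -pE in p'c1; rewrite -pE2 in p'c2.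
have c12 : c1 < c2.
  have [lt_uv | vu] := ltP u v; first by move: (uc1v' lt_uv); lra.
  have lt_vw : v < w by move: uw; rewrite neq_lt; lra.
  by move: (vc2w' lt_vw); lra.
have [//|c] := @poly_rolle _ c1 c2 p^`() c12; first by rewrite p'c1 p'c2.
by rewrite in_itv /= => c1cc2 /noroot []; lra.
Qed.

Lemma convex_triple_root (R : rcfType) (p q : {poly R}) a b u v w :
    (forall x, a < x < b -> 0 < p^`()^`().[x]) ->
    a <= u < b -> a <= v < b -> a <= w < b ->
    p = ('X - u%:P) * (('X - v%:P) * (('X - w%:P) * q)) ->
  [/\ u = a, v = a & w = a].
Proof.
move=> p''_gt0 aub avb awb pE.
have all_a x y z : x <= y <= z -> a <= x -> z < b ->
    p = ('X - x%:P) * (('X - y%:P) * (('X - z%:P) * q)) -> [/\ x = a, y = a & z = a].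
  move=> /andP[xy yz] ax zb /(convex_triple_root_le p''_gt0 ax xy yz zb) za.
  by split=> //; lra.
have [uv|vu] := leP u v; have [vw|wv] := leP v w; have [uw|wu] := leP u w.
- by apply: all_a => //; lra.
- by lra.
- by have [] := all_a u w v ltac:(lra) ltac:(lra) ltac:(lra) ltac:(rewrite pE; ring).
- by have [] := all_a w u v ltac:(lra) ltac:(lra) ltac:(lra) ltac:(rewrite pE; ring).
- by have [] := all_a v u w ltac:(lra) ltac:(lra) ltac:(lra) ltac:(rewrite pE; ring).
- by have [] := all_a v w u ltac:(lra) ltac:(lra) ltac:(lra) ltac:(rewrite pE; ring).
- by lra.
- by have [] := all_a w v u ltac:(lra) ltac:(lra) ltac:(lra) ltac:(rewrite pE; ring).
Qed.

(** Write p = (x - z) q. Then q(b) > 0 and q(a) <= 0, the latter because q(a) = p'(a) when z = a; so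
    q has a root w in [a, b). A third root would make all three equal to a, against p'(a) < 0. *)
Lemma count_roots_convex (R : rcfType) (p : {poly R}) a b z :
    (forall x, a < x < b -> 0 < p^`()^`().[x]) ->
    0 <= p.[a] -> 0 < p.[b] -> a <= z < b -> root p z ->
    (z = a -> p^`().[a] < 0) ->
  count_roots (fun x => a <= x < b) p = 2%N.
Proof.
move=> p''_gt0 pa pb /[dup] azb /andP[az zb] /factor_theorem[q].
rewrite mulrC => pE za.
have qb : 0 < q.[b] by move: pb; rewrite pE !hornerE pmulr_rgt0 // subr_gt0.
have qa : q.[a] <= 0.
  have [aE|az_neq] := eqVneq z a.
    have <- : p^`().[a] = q.[a] by rewrite pE aE derivM !derivE !hornerE /=; ring.
    exact: ltW (za aE).
  by move: pa; rewrite pE !hornerE nmulr_rge0 // subr_lt0 lt_neqAle eq_sym az_neq.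
have [|w awb] := @poly_ivt _ q a b (ltW (le_lt_trans az zb)).
  by rewrite qa ltW.
case/factor_theorem=> r; rewrite mulrC => qE.
have wb : w < b.
  rewrite lt_neqAle andbC; case/andP: awb => _ -> /=.
  by apply: contraTneq qb => <-; rewrite qE !hornerE subrr mul0r ltxx.
have r0 : r != 0 by apply: contraTneq qb => r0; rewrite qE r0 mulr0 horner0 ltxx.
rewrite pE count_roots_XsubCM //; last by rewrite qE mulf_neq0 ?polyXsubC_eq0.
rewrite qE count_roots_XsubCM //; last by rewrite wb; case/andP: awb => ->.
rewrite count_roots_eq0 // => v avb; apply/negP => /factor_theorem[s].
rewrite mulrC => rE; rewrite qE rE in pE.
have [|z_a w_a v_a] := convex_triple_root p''_gt0 azb _ avb pE.
  by rewrite wb; case/andP: awb => ->.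
have p'a : p^`().[a] = 0.
  by rewrite pE z_a w_a v_a !(derivM, derivE) !hornerE /=; ring.
by have := za z_a; rewrite p'a ltxx.
Qed.

(** Rolle gives a zero c of the increasing p', so p decreases on [a, c] and increases on [c, b]. *)
Lemma convex_lt0 (R : rcfType) (p : {poly R}) a b : a < b ->
    (forall x, a < x < b -> 0 < p^`()^`().[x]) -> p.[a] = 0 -> p.[b] = 0 ->
  [/\ p^`().[a] < 0, 0 < p^`().[b] & forall x, a < x < b -> p.[x] < 0].
Proof.
move=> ab p''_gt0 pa pb.
have [|c] := @poly_rolle _ a b p ab; first by rewrite pa pb.
rewrite in_itv /= => /andP[ac cb] p'c.
have p'_incr : {in `[a, b] &, {homo horner p^`() : x y / x < y}}.
  by apply: ltr_hornerW => x; rewrite in_itv; apply: p''_gt0.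
have p'_lt0 x : a <= x < c -> p^`().[x] < 0.
  by move=> axc; rewrite -p'c; apply: p'_incr; rewrite ?in_itv /=; lra.
have p'_gt0 x : c < x <= b -> 0 < p^`().[x].
  by move=> axc; rewrite -p'c; apply: p'_incr; rewrite ?in_itv /=; lra.
split; [by apply: p'_lt0; lra | by apply: p'_gt0; lra | move=> x axb].
have [xc|cx] := leP x c.
  rewrite -pa; apply: (@dernr _ p a c); last by rewrite in_itv /=; lra.
  by move=> t; rewrite in_itv /= => ?; apply: p'_lt0; lra.
rewrite -pb; apply: (@derpl _ p c b); last by rewrite in_itv /=; lra.
by move=> t; rewrite in_itv /= => ?; apply: p'_gt0; lra.
Qed.

(** * Splitting and reflecting root counts *)

Lemma eq_count_roots (R : rcfType) (P Q : pred R) (p : {poly R}) :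
  (forall z, root p z -> P z = Q z) -> count_roots P p = count_roots Q p.
Proof.
move=> PQ; rewrite /count_roots big_seq_cond [RHS]big_seq_cond.
by apply: eq_bigl => z; case: (boolP (z \in rootsR p)) => // /root_roots /PQ ->.
Qed.

Lemma count_rootsID (R : rcfType) (Q P : pred R) (p : {poly R}) :
  count_roots P p = (count_roots (fun z => P z && Q z) p +
                     count_roots (fun z => P z && ~~ Q z) p)%N.
Proof. exact: bigID. Qed.

Lemma count_roots_simple (R : rcfType) (p : {poly R}) z :
  root p z -> p^`().[z] != 0 -> count_roots (pred1 z) p = 1%N.
Proof.
case/factor_theorem=> q; rewrite mulrC => ->.
rewrite derivM !derivE !hornerE /= subrr mul0r addr0 => q_neq0.
rewrite count_roots_XsubCM /= ?eqxx //.
  by rewrite count_roots_eq0 // => x /eqP ->.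
by apply: contraNneq q_neq0 => ->; rewrite horner0.
Qed.

(** The intermediate value theorem applies to q = p / (x - a), since q(a) = p'(a) < 0 < q(b). *)
Lemma exists_root_gt (R : rcfType) (p : {poly R}) a b :
    a < b -> root p a -> p^`().[a] < 0 -> 0 < p.[b] ->
  exists2 w, a < w < b & root p w.
Proof.
move=> ab /factor_theorem[q]; rewrite mulrC => pE p'a pb.
have p'aE : p^`().[a] = q.[a] by rewrite pE derivM !derivE !hornerE /=; ring.
rewrite {}p'aE in p'a.
have qb : 0 < q.[b] by move: pb; rewrite pE !hornerE pmulr_rgt0 // subr_gt0.
have [|w /andP[aw wb] qw] := @poly_ivt _ q a b (ltW ab); first by rewrite !ltW.
exists w; last by rewrite pE rootM qw orbT.
rewrite !lt_neqAle aw wb !andbT; apply/andP; split; apply/eqP => wE.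
  by move: p'a; rewrite wE (eqP qw) ltxx.
by move: qb; rewrite -wE (eqP qw) ltxx.
Qed.

(** Substituting 1 - x turns a divisor (x - (1 - z))^n of p into a divisor (x - z)^n of c p, up to
    sign; c is nonzero because the substitution is an involution. *)
Lemma mup_reflect_le (R : rcfType) (p : {poly R}) c z : p != 0 ->
  p \Po (1 - 'X) = c *: p -> (mup (1 - z) p <= mup z p)%N.
Proof.
move=> p0 pE; rewrite mup_geq //.
have c0 : c != 0.
  apply: contraNneq p0 => c0; rewrite c0 scale0r in pE.
  have := congr1 (fun q => q \Po (1 - 'X)) pE; rewrite -comp_polyA comp_polyB.
  by rewrite comp_polyX comp_polyC opprB addrC subrK comp_polyXr comp_poly0 => ->.
rewrite -(dvdpZr _ _ c0) -pE.
have: ('X - (1 - z)%:P) ^+ (mup (1 - z) p) %| p by rewrite -mup_geq.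
case/dvdpP=> q; set n := mup _ _ => ->; rewrite comp_polyM dvdp_mull //.
rewrite rmorphXn /= dvdp_exp2r // comp_polyB comp_polyX comp_polyC.
have -> : 1 - 'X - (1 - z)%:P = - ('X - z%:P) by rewrite polyCB; ring.
by rewrite dvdpNr.
Qed.

Lemma count_roots_reflect (R : rcfType) (P : pred R) (p : {poly R}) c :
    p != 0 -> p \Po (1 - 'X) = c *: p ->
  count_roots P p = count_roots (fun z => P (1 - z)) p.
Proof.
move=> p0 pE.
have mup_sym z : mup (1 - z) p = mup z p.
  apply/eqP; rewrite eqn_leq (mup_reflect_le _ p0 pE) /=.
  by rewrite -{1}[z](subKr 1) (mup_reflect_le _ p0 pE).
rewrite (@count_rootsE _ _ _ [seq 1 - z | z <- rootsR p]) //.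
- by rewrite big_map; apply: eq_bigr => z _; rewrite mup_sym.
- by rewrite map_inj_uniq ?uniq_roots // => x y /subrI.
move=> z _ pz; apply/mapP; exists (1 - z); last by rewrite subKr.
rewrite mem_rootsR // -dvdp_XsubCl XsubC_dvd // mup_sym -XsubC_dvd //.
by rewrite dvdp_XsubCl.
Qed.

(** * Values and signs of real Bernoulli polynomials *)

Section RealBernoulli.

Variables (R : realType) (B : nat -> {poly rat}).
Hypothesis hB : bernoulli_polys B.

Local Notation b n := (real_poly R (B n)).

Lemma horner_bernoulli_reflect n x : (b n).[1 - x] = (-1) ^+ n * (b n).[x].
Proof.
have := congr1 (horner^~ x) (real_bernoulli_reflect R n hB).
by rewrite horner_comp !hornerE.
Qed.

Lemma bernoulli_half n : odd n -> (b n).[1 / 2] = 0.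
Proof.
move=> odd_n; have := horner_bernoulli_reflect n (1 / 2).
have -> : 1 - 1 / 2 = 1 / 2 :> R by field.
by rewrite -signr_odd odd_n expr1; lra.
Qed.

Lemma bernoulli_at1 n : (b n.+2).[1] = (b n.+2).[0].
Proof.
by have := real_bernoulli_shift n.+1 (0 : R) hB; rewrite add0r expr0n mulr0 addr0.
Qed.

Lemma odd_bernoulli_at0 n : odd n -> (b n.+2).[0] = 0.
Proof.
move=> odd_n; have := horner_bernoulli_reflect n.+2 0.
by rewrite subr0 bernoulli_at1 -signr_odd /= odd_n expr1; lra.
Qed.

Lemma deriv2_bernoulli n :
  (b n.+2)^`()^`() = (n.+2%:R * n.+1%:R) *: b n.
Proof. by rewrite !deriv_real_bernoulli // derivZ deriv_real_bernoulli // scalerA. Qed.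

Lemma deriv_bernoulli1 x : (b 1)^`().[x] = 1.
Proof.
rewrite deriv_real_bernoulli // hornerZ mul1r bernoulli0 //.
by rewrite /real_poly rmorph1 hornerC.
Qed.

Lemma bernoulli1_lt0 x : x < 1 / 2 -> (b 1).[x] < 0.
Proof.
move=> x_lt; rewrite -(bernoulli_half (isT : odd 1)).
apply: (@derpl _ _ x); last by rewrite in_itv /= lexx.
by move=> t _; rewrite deriv_bernoulli1 ltr01.
Qed.

Lemma root_bernoulli1_half x : root (b 1) x -> x = 1 / 2.
Proof.
move=> /eqP px; have [xh|xh|//] := ltgtP x (1 / 2).
  by have := bernoulli1_lt0 xh; rewrite px ltxx.
have : (b 1).[1 - x] < 0 by apply: bernoulli1_lt0; lra.
by rewrite horner_bernoulli_reflect px mulr0 ltxx.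
Qed.

Lemma num_roots_bernoulli1 : num_roots (b 1) = 1%N.
Proof.
apply: etrans (@count_roots_simple _ (b 1) (1 / 2) _ _).
- by apply: eq_count_roots => x /root_bernoulli1_half ->; rewrite /= eqxx.
- by rewrite rootE bernoulli_half.
by rewrite deriv_bernoulli1 oner_neq0.
Qed.

(* A convex function vanishing at both ends of [0, 1/2] is negative inside, so the
   sign of b_{2j+1} on (0, 1/2) alternates with j. *)
Lemma odd_bernoulli_step j :
    (forall x, 0 < x < 1 / 2 -> (-1) ^+ j * (b j.*2.+1).[x] < 0) ->
  [/\ (-1) ^+ j.+1 * (b j.*2.+3)^`().[0] < 0,
      0 < (-1) ^+ j.+1 * (b j.*2.+3)^`().[1 / 2] &
      forall x, 0 < x < 1 / 2 -> (-1) ^+ j.+1 * (b j.*2.+3).[x] < 0].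
Proof.
move=> IHj; set p := (-1) ^+ j.+1 *: b j.*2.+3.
have [|x xh|||p'0 p'h p_lt0] := @convex_lt0 _ p 0 (1 / 2); first by lra.
- rewrite !derivZ deriv2_bernoulli !hornerZ exprS mulN1r mulNr oppr_gt0.
  by rewrite mulrCA pmulr_rlt0 ?IHj // mulr_gt0 ?ltr0n.
- by rewrite hornerZ odd_bernoulli_at0 ?mulr0 //= odd_double.
- by rewrite hornerZ bernoulli_half ?mulr0 //= odd_double.
split; first by rewrite -hornerZ -derivZ.
  by rewrite -hornerZ -derivZ.
by move=> x xh; rewrite -hornerZ p_lt0.
Qed.

Lemma odd_bernoulli_sign j x :
  0 < x < 1 / 2 -> (-1) ^+ j * (b j.*2.+1).[x] < 0.
Proof.
elim: j x => [|j IHj] x; first by case/andP=> _ xh; rewrite mul1r bernoulli1_lt0.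
by case: (odd_bernoulli_step IHj) => _ _; apply.
Qed.

(** Each unit step from a point t >= 0 adds (n+1) t^n >= 0. This and its strict variant carry sign
    information from [0, 1) to the right. *)
Lemma bernoulli_shiftn n m x :
  0 <= x -> (b n.+1).[x] <= (b n.+1).[x + m%:R].
Proof.
move=> x0; elim: m => [|m IHm]; first by rewrite addr0.
rewrite -natr1 addrA real_bernoulli_shift // (le_trans IHm) // lerDl.
by rewrite mulr_ge0 ?exprn_ge0 ?addr_ge0.
Qed.

Lemma bernoulli_shiftn_lt n m x :
  0 < x -> (b n.+1).[x] < (b n.+1).[x + m.+1%:R].
Proof.
move=> x0; rewrite -natr1 addrA real_bernoulli_shift //.
rewrite (le_lt_trans (bernoulli_shiftn n m (ltW x0))) // ltrDl.
by rewrite mulr_gt0 ?ltr0n // exprn_gt0 // ltr_wpDr.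
Qed.

(** * Roots of the Bernoulli polynomial of index 4k + 5 *)

Section Odd1Mod4.

Variable k : nat.

(** Chosen so that [b n.+2] is the polynomial under study and [b n] is its second derivative up to a
    positive factor. *)
Local Notation n := (4 * k + 3)%N.

Lemma bernoulli_sub2_gt0 x : 0 < x < 1 / 2 -> 0 < (b n).[x].
Proof.
(* The index in [odd_bernoulli_sign] is j = 2k + 1, which is odd, so the sign flips. *)
have -> : n = k.*2.+1.*2.+1 by lia.
move=> xh; have := odd_bernoulli_sign k.*2.+1 xh.
by rewrite -signr_odd /= odd_double expr1 mulN1r oppr_lt0.
Qed.

Lemma bernoulli_signs :
  [/\ (b n.+2)^`().[0] < 0, 0 < (b n.+2)^`().[1 / 2] &
      forall x, 0 < x < 1 / 2 -> (b n.+2).[x] < 0].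
Proof.
have := odd_bernoulli_step (@odd_bernoulli_sign k.*2.+1).
have <- : n.+2 = k.*2.+1.*2.+3 by lia.
rewrite -signr_odd /= odd_double /= expr0 !mul1r => -[-> -> H].
by split=> // x /H; rewrite mul1r.
Qed.

Lemma bernoulli_neq0 : b n.+2 != 0.
Proof.
have [p'0 _ _] := bernoulli_signs.
by apply: contraTneq p'0 => ->; rewrite deriv0 horner0 ltxx.
Qed.

(** The derivative is a multiple of [b n.+1], which takes equal values at 0 and 1. *)
Lemma bernoulli_deriv1_lt0 : (b n.+2)^`().[1] < 0.
Proof.
have [p'0 _ _] := bernoulli_signs; move: p'0.
rewrite deriv_real_bernoulli // !hornerZ.
by have -> : n = (4 * k + 2).+1; [lia | rewrite bernoulli_at1].
Qed.

Lemma odd_4k3 : odd n. Proof. by rewrite oddD oddM. Qed.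

Lemma root1_bernoulli : root (b n.+2) 1.
Proof. by rewrite rootE bernoulli_at1 odd_bernoulli_at0 // odd_4k3. Qed.

Lemma bernoulli_gt0_right x : 1 / 2 < x < 1 -> 0 < (b n.+2).[x].
Proof.
move=> xh; have [_ _ /(_ (1 - x))] := bernoulli_signs.
rewrite horner_bernoulli_reflect -signr_odd /= odd_4k3 /= expr1 mulN1r oppr_lt0.
by apply; lra.
Qed.

Lemma bernoulli_nat_gt0 m : 0 < (b n.+2).[m.+2%:R].
Proof.
have := @bernoulli_shiftn_lt n.+1 m 1 ltr01.
by rewrite (eqP root1_bernoulli) nat1r.
Qed.

Lemma bernoulli_right_gt0 m x :
  m.+1%:R + 1 / 2 <= x < m.+2%:R -> 0 < (b n.+2).[x].
Proof.
rewrite -(natr1 m.+1) => xm.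
have -> : x = (x - m.+1%:R) + m.+1%:R by rewrite subrK.
(* Strictness must come from the shift, since the polynomial vanishes at 1/2. *)
apply: (le_lt_trans _ (bernoulli_shiftn_lt _ _ _)); last by lra.
have [xh|xh] := eqVneq (x - m.+1%:R) (1 / 2).
  by rewrite xh bernoulli_half //= odd_4k3.
by apply/ltW/bernoulli_gt0_right; move: xh; rewrite neq_lt; lra.
Qed.

Lemma count_roots_bernoulli_unit m z :
    m.+1%:R <= z < m.+2%:R -> root (b n.+2) z ->
  count_roots (fun x => m.+1%:R <= x < m.+2%:R) (b n.+2) = 2%N.
Proof.
(* The right half of the interval is free of roots; convexity is available on the left half. *)
have rootP x : root (b n.+2) x ->
    (m.+1%:R <= x < m.+2%:R) = (m.+1%:R <= x < m.+1%:R + 1 / 2).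
  move=> /eqP px; rewrite -(natr1 m.+1); apply/idP/idP => xm; last by lra.
  have [xh|xh] := ltP x (m.+1%:R + 1 / 2); first by lra.
  have := @bernoulli_right_gt0 m x; rewrite px ltxx -(natr1 m.+1) => H.
  by have: false by apply: H; lra.
move=> zm pz; rewrite (eq_count_roots rootP).
apply: (count_roots_convex _ _ _ _ pz).
- move=> x xm; rewrite deriv2_bernoulli hornerZ mulr_gt0 ?mulr_gt0 ?ltr0n //.
  have -> : x = (x - m.+1%:R) + m.+1%:R by rewrite subrK.
  have nE : n = (4 * k + 2).+1 by lia.
  rewrite nE; apply: (lt_le_trans _ (bernoulli_shiftn _ _ _)); last by lra.
  by rewrite -nE; apply: bernoulli_sub2_gt0; lra.
- case: m {zm rootP} => [|m]; first by rewrite (eqP root1_bernoulli).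
  exact/ltW/bernoulli_nat_gt0.
- by apply: (@bernoulli_right_gt0 m); rewrite -(natr1 m.+1); lra.
- by rewrite -rootP.
(* A root at the left endpoint is possible only when that endpoint is 1. *)
case: m {zm rootP} => [|m] zE; first exact: bernoulli_deriv1_lt0.
by have := bernoulli_nat_gt0 m; rewrite -zE (eqP pz) ltxx.
Qed.

(* Translating the root y down by an integer into [m + 1, m + 2) can only decrease
   the value, by the shift equation. *)
Lemma exists_root_below m y :
    root (b n.+2) y -> m.+2%:R <= y ->
  exists2 z, m.+1%:R <= z < m.+2%:R & root (b n.+2) z.
Proof.
move=> /eqP py my.
have [t] : exists2 t, m.+1%:R <= t < m.+2%:R & (b n.+2).[t] <= 0.
  have y_ge0 : 0 <= y - m.+1%:R by move: my; rewrite -(natr1 m.+1); lra.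
  have := truncn_itv y_ge0; set i := Num.truncn _; rewrite -(natr1 i) => iy.
  exists (y - i%:R); first by rewrite -(natr1 m.+1); lra.
  rewrite -py -[y in leRHS](subrK i%:R) bernoulli_shiftn //.
  by have := ler0n R m.+1; lra.
case: m {my} => [|m] /andP[mt tm] pt.
  by exists 1; [rewrite lexx ltr1n | exact: root1_bernoulli].
have [|z /andP[mz zt]] := @poly_ivt _ (- b n.+2) m.+2%:R t mt.
  by rewrite !hornerN oppr_le0 oppr_ge0 pt ltW // bernoulli_nat_gt0.
by rewrite rootN => pz; exists z => //; rewrite mz (le_lt_trans zt).
Qed.

(** By [exists_root_below] no unit interval between 1 and y is free of roots, so each contributes
    exactly two. *)
Lemma count_roots_bernoulli m y : root (b n.+2) y -> m.+1%:R <= y < m.+2%:R ->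
  count_roots (fun x => 1 <= x < m.+2%:R) (b n.+2) = (2 * m.+1)%N.
Proof.
move=> py /andP[my ym].
have unit_root i : (i <= m)%N ->
    exists2 z, i.+1%:R <= z < i.+2%:R & root (b n.+2) z.
  rewrite leq_eqVlt => /predU1P[-> | im]; first by exists y; rewrite ?my.
  by apply: (exists_root_below py); rewrite (le_trans _ my) // ler_nat.
elim: m {my ym} unit_root => [|m IHm] unit_root.
  by have [z] := unit_root 0%N isT; apply: count_roots_bernoulli_unit.
rewrite (count_rootsID (fun x => x < m.+2%:R)) mulnS addnC; congr (_ + _)%N.
  have [z zm pz] := unit_root m.+1 (leqnn _).
  apply: etrans (count_roots_bernoulli_unit zm pz); apply: eq_count_roots => x _.
  rewrite -leNgt; case: (leP m.+2%:R x) => [mx|]; rewrite ?andbF // andbT.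
  by rewrite (le_trans _ mx) // ler1n.
rewrite -IHm; last by move=> i im; apply: unit_root; apply: leqW.
apply: eq_count_roots => x _; case: (ltP x m.+2%:R) => [xm|]; rewrite ?andbF // !andbT.
by rewrite (lt_trans xm) ?ltr_nat // andbT.
Qed.

(** The negative slope at the root 1 and the positive value at 2 force a root in (1, 2), so y > 1;
    no integer above 1 is a root. Strictness on the left makes the ceiling of y equal to m + 2. *)
Lemma largest_root_bernoulli y : largest_root (b n.+2) y ->
  exists m, m.+1%:R < y < m.+2%:R.
Proof.
case=> py y_max.
have [|w w1 pw] := exists_root_gt _ root1_bernoulli bernoulli_deriv1_lt0
  (bernoulli_nat_gt0 0).
  by rewrite ltr1n.
have y1 : 1 < y by have := y_max w pw; lra.
have y0 : 0 <= y by lra.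
have := truncn_itv y0; case: (Num.truncn y) => [|[|m]] ym; first by lra.
  by exists 0%N; rewrite y1; case/andP: ym.
exists m.+1; case/andP: ym => my ->; rewrite andbT lt_neqAle my andbT.
by apply: contraTneq py => <-; rewrite rootE gt_eqF // bernoulli_nat_gt0.
Qed.

Lemma num_roots_bernoulli y m : largest_root (b n.+2) y ->
  m.+1%:R < y < m.+2%:R -> num_roots (b n.+2) = (4 * m.+1 + 1)%N.
Proof.
move=> [py y_max] /andP[my ym].
have [_ p'h _] := bernoulli_signs.
(* No root lies in (1/2, 1), and none beyond y, so only [1, m + 2) counts. *)
have right : count_roots (fun x => 1 / 2 < x) (b n.+2) = (2 * m.+1)%N.
  rewrite -(count_roots_bernoulli py); last by rewrite ltW.
  apply: eq_count_roots => x px; have xy := y_max x px.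
  rewrite (le_lt_trans xy ym) andbT; apply/idP/idP => [xh|]; last by lra.
  rewrite leNgt; apply: contraTN px => x1; rewrite rootE gt_eqF //.
  by apply: bernoulli_gt0_right; rewrite xh.
have left : count_roots (fun x => x < 1 / 2) (b n.+2) = (2 * m.+1)%N.
  rewrite -right [RHS](count_roots_reflect _ bernoulli_neq0
    (real_bernoulli_reflect R n.+2 hB)).
  by apply: eq_count_roots => x _; apply/idP/idP; lra.
have half : count_roots (pred1 (1 / 2)) (b n.+2) = 1%N.
  apply: count_roots_simple; last by rewrite gt_eqF.
  by rewrite rootE bernoulli_half //= odd_4k3.
(* The total splits into the roots below, at and above 1/2. *)
rewrite -[LHS]/(count_roots xpredT (b n.+2)).
rewrite (count_rootsID (fun x => x < 1 / 2)) left.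
rewrite (count_rootsID (pred1 (1 / 2))) (@eq_count_roots _ _ (pred1 (1 / 2))).
  rewrite half (@eq_count_roots _ _ (fun x => 1 / 2 < x)); first by rewrite right; lia.
  by move=> x _ /=; rewrite -leNgt lt_neqAle eq_sym andbC.
by move=> x _ /=; case: eqVneq => [->|]; rewrite ?ltxx ?andbF.
Qed.

End Odd1Mod4.
End RealBernoulli.

Theorem theorem2 (R : realType) (B : nat -> {poly rat}) (hB : bernoulli_polys B)
    (k : nat) (y : R) (hy : largest_root (real_poly R (B (4 * k + 1)%N)) y) :
  (num_roots (real_poly R (B (4 * k + 1)%N)))%:Z = 4 * Num.ceil y - 3.
Proof.
(* B_1 is separate: its only root 1/2 has ceiling 1. Otherwise the ceiling is m + 2, and 4(m + 1) +
   1 = 4(m + 2) - 3. *)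
case: k hy => [|k]; last first.
  have -> : (4 * k.+1 + 1 = (4 * k + 3).+2)%N by lia.
  move=> hy; have [m ym] := largest_root_bernoulli hB hy.
  rewrite (num_roots_bernoulli hB hy ym).
  have -> : Num.ceil y = m.+2; last by lia.
  case/andP: ym => my ym; apply: ceil_def.
  by have -> : (m.+2%:Z - 1 = m.+1)%R by []; rewrite my ltW.
rewrite muln0 add0n => -[py _]; rewrite num_roots_bernoulli1 //.
by rewrite (root_bernoulli1_half hB py) (@ceil_def _ _ 1) //; lra.
Qed.
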